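(* The mechanism $(\mathcal{M},(\hat x_i)_{i\in\mathcal{N}},(\hat t_i)_{i\in\mathcal{N}})$ defined in the context is distributed with respect to the message graph $\mathcal{GR}$: for every agent $i\in\mathcal{N}$, the values $\hat x_i(m)$ and $\hat t_i(m)$ depend only on agent $i$'s own message $m_i$ and on the messages $(m_j)_{j\in\mathcal{N}(i)}$ of her neighbors in $\mathcal{GR}$.
   Context: **Data network.** $\mathcal{N}=\{1,\dots,N\}$ (agents), $\mathcal{K}=\{1,\dots,K\}$ (groups), $\mathcal{L}=\{1,\dots,L\}$ (links). Each agent $i$ belongs to exactly one group $k(i)$; $\mathcal{G}_k=\{i:k(i)=k\}$. Agent $i$ uses the links $\mathcal{L}_i\subset\mathcal{L}$, $L_i=|\mathcal{L}_i|$. For each link $l$: $\mathcal{N}^l=\{i:l\in\mathcal{L}_i\}$, $\mathcal{G}_k^l=\mathcal{N}^l\cap\mathcal{G}_k$, $\mathcal{K}^l=\{k:\mathcal{G}_k^l\neq\emptyset\}$, with $|\mathcal{K}^l|\ge 2$, and the capacity is $c^l>0$. **Message graph.** $\mathcal{GR}=(\mathcal{N},\mathcal{E})$ is an undirected tree on $\mathcal{N}$; $\mathcal{N}(i)$ is the set of neighbors of $i$ in $\mathcal{GR}$, $N(i)=|\mathcal{N}(i)|$, $\mathcal{N}^l(i)=\mathcal{N}(i)\cap\mathcal{N}^l$, $N^l(i)=|\mathcal{N}^l(i)|$. $\Phi:\mathcal{N}\to\mathcal{N}$ is an arbitrary fixed function with $\Phi(i)\in\mathcal{N}(i)$, and $I_i=\{h\in\mathcal{N}(i):\Phi(h)=i\}$.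 Standing assumption: for each $l\in\mathcal{L}$ the subgraph of $\mathcal{GR}$ on $\mathcal{N}^l$ is connected, and for each $l\in\mathcal{L}$, $k\in\mathcal{K}^l$ there is a node of $\mathcal{G}_k^l$ adjacent to all other nodes of $\mathcal{G}_k^l$; one such node is fixed and denoted $c(k,l)$. $\mathcal{C}_i=\{l\in\mathcal{L}_i:c(k(i),l)=i\}$. **Messages.** Agent $i$'s message is $m_i=(y_i,\underline{y_i},n_i,q_i,p_i,w_i,z_i,a_i)\in\mathcal{M}_i$ where: $y_i\in\mathbb{R}_+$; $\underline{y_i}=(\underline{y_i}^l)_{l\in\mathcal{L}_i}\in\mathbb{R}_+^{L_i}$; $n_i=(n_i^{j,l})_{j\in\mathcal{N}(i),l\in\mathcal{L}}$ with entries in $\mathbb{R}_+$; $q_i=(q_i^j)_{j\in I_i}$ with entries in $\mathbb{R}_+$; $p_i=({}^1p_i,{}^2p_i)$ with ${}^1p_i=({}^1p_i^l)_{l\in\mathcal{L}_i}$, ${}^2p_i=({}^2p_i^{j,l})_{j\in I_i,l\in\mathcal{L}_j}$, entries in $\mathbb{R}_+$; $w_i=(w_i^l)_{l\in\mathcal{L}_i}$ with entries in $\mathbb{R}_+$; $z_i=({}^1z_i,{}^2z_i)$ with ${}^1z_i=({}^1z_i^l)_{l\in\mathcal{C}_i}$, ${}^2z_i=({}^2z_i^l)_{l\in\mathcal{C}_i}$, entries in $\mathbb{R}_+$; $a_i=({}^1a_i,{}^2a_i)$ with ${}^1a_i=({}^1a_i^l)_{l\in\mathcal{L}_i}$, ${}^2a_i=({}^2a_i^{j,l})_{j\in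 I_i,l\in\mathcal{L}_j}$, entries in $\mathbb{R}_{++}=(0,\infty)$. $\mathcal{M}=\mathcal{M}_1\times\dots\times\mathcal{M}_N$. **Derived quantities.** $\mathbf{1}_{\{\alpha\}}(\beta)=1$ if $\alpha=\beta$, else $0$. $y_i^l=\underline{y_i}^l$ if $l\in\mathcal{L}_i$, $y_i^l=0$ otherwise. For $l\in\mathcal{L}_i$: if $l\in\mathcal{C}_i$, $${}^1\bar z_i^l=\max\{q_{\Phi(i)}^i,\max_{j\in\mathcal{G}_{k(i)}^l,j\ne i}y_j\},\qquad {}^2\bar z_i^l=\mathbf{1}_{\{q_{\Phi(i)}^i\}}({}^1\bar z_i^l)+\sum_{j\in\mathcal{G}_{k(i)}^l,j\neq i}\mathbf{1}_{\{y_j\}}({}^1\bar z_i^l),$$ and if $l\notin\mathcal{C}_i$, ${}^1\bar z_i^l={}^1z_{c(k(i),l)}^l$, ${}^2\bar z_i^l={}^2z_{c(k(i),l)}^l$. Write $\delta_i^l=\dfrac{q_{\Phi(i)}^i\mathbf{1}_{\{q_{\Phi(i)}^i\}}({}^1\bar z_i^l)}{{}^2\bar z_i^l}$ for $l\in\mathcal{L}_i$. **Allocation.** $\hat x_i(m)=r_iy_i$, $r_i=\min_{l\in\mathcal{L}}c^l/f_i^l$, where $f_i^l=\delta_i^l+\sum_{j\in\mathcal{N}(i)}\big(y_j^l+\sum_{h\in\mathcal{N}(j),h\ne i}n_j^{h,l}\big)$ for $l\in\mathcal{L}_i$ and $f_i^l=\sum_{j\in\mathcal{N}(i)}\big(y_j^l+\sum_{h\in\mathcal{N}(j),h\ne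 i}n_j^{h,l}\big)$ for $l\notin\mathcal{L}_i$. (No convention for vanishing denominators is specified.) **Tax.** $\hat t_i(m)=\hat t_i^{\mathfrak{c}}(m)+\sum_{l\in\mathcal{L}}\hat t_i^l(m)$, where $$\hat t_i^{\mathfrak{c}}(m)=\sum_{j\in I_i}\sum_{l\in\mathcal{L}_j}\big(({}^2p_i^{j,l}-{}^1p_j^l)^2+({}^2a_i^{j,l}-{}^1a_j^l)^2\big)+\sum_{j\in I_i}(q_i^j-y_j)^2.$$ Put $S_i^l=\sum_{j\in\mathcal{N}(i)}\big(n_i^{j,l}-y_j^l-\sum_{h\in\mathcal{N}(j),h\ne i}n_j^{h,l}\big)^2$. For $l\notin\mathcal{L}_i$: $\hat t_i^l(m)=S_i^l$. For $l\in\mathcal{L}_i$ put $$B_i^l={}^2p_{\Phi(i)}^{i,l}\hat x_i(m)+S_i^l+(\underline{y_i}^l-\delta_i^l)^2+\bar w_{-i}^l(\hat w_i^l-\bar w_{-i}^l)(c^l-r_if_i^l)^2+(\hat w_i^l-\bar w_{-i}^l)^2+{}^2p_{\Phi(i)}^{i,l}({}^1p_i^l-{}^2p_{\Phi(i)}^{i,l})({}^1\bar z_i^l-q_{\Phi(i)}^i)^2.$$ For $l\in\mathcal{L}_i\setminus\mathcal{C}_i$: $\hat t_i^l(m)=B_i^l+(w_i^l-w_{c(k(i),l)}^l)^2$. For $l\in\mathcal{C}_i$: $\hat t_i^l(m)=B_i^l+({}^1z_i^l-{}^1\bar z_i^l)^2+({}^2z_i^l-{}^2\bar z_i^l)^2+\big(w_i^l-{}^2p_{\Phi(i)}^{i,l}-\sum_{j\in\mathcal{G}_{k(i)}^l,j\ne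 i}{}^1p_j^l\big)^2$. Here $\bar w_{-i}^l=\frac1{N^l(i)}\sum_{j\in\mathcal{N}^l(i)}w_j^l$, and $\hat w_i^l=\sum_{j\in\mathcal{G}_{k(i)}^l}{}^1p_j^l+({}^1a_i^l-{}^2a_{\Phi(i)}^{i,l})$ if $l\in\mathcal{C}_i$, $\hat w_i^l=w_{c(k(i),l)}^l-{}^2p_{\Phi(i)}^{i,l}+{}^1p_i^l+({}^1a_i^l-{}^2a_{\Phi(i)}^{i,l})$ if $l\in\mathcal{L}_i\setminus\mathcal{C}_i$. *)

(* Defs.v *)
From HB Require Import structures.
From mathcomp Require Import all_boot all_order all_algebra.
From mathcomp Require Import interval_inference reals.

Set Implicit Arguments.
Unset Strict Implicit.
Unset Printing Implicit Defensive.

Import Order.TTheory GRing.Theory Num.Theory.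
Local Open Scope ring_scope.

(* Messages are compared by Leibniz equality: m and m' may differ arbitrarily
   at the agents that are neither i nor adjacent to i. *)
Record mechanism (R : Type) (A : Type) := Mechanism {
  msg : A -> Type;
  alloc : (forall i, msg i) -> A -> R;
  tax : (forall i, msg i) -> A -> R }.

Definition distributed (R A : Type) (e : rel A) (G : mechanism R A) : Prop :=
  forall (i : A) (m m' : forall j, msg G j),
    (forall j, j = i \/ e i j -> m j = m' j) ->
    alloc m i = alloc m' i /\ tax m i = tax m' i.

(* [links i] is L_i, [capacity l] is c^l, [center k l] is c(k,l); the latter
   is meaningful only for k in K^l, and is only ever used there. *)
Record network (R : realType) := Network {
  nagents : nat;
  ngroups : nat;
  nlinks : nat;
  nlinks_gt0 : (0 < nlinks)%N;
  group_of : 'I_nagents -> 'I_ngroups;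
  links : 'I_nagents -> {set 'I_nlinks};
  capacity : 'I_nlinks -> R;
  adj : rel 'I_nagents;
  Phi : 'I_nagents -> 'I_nagents;
  center : 'I_ngroups -> 'I_nlinks -> 'I_nagents }.

Section Network.
Context {R : realType} (D : network R).

Definition agent := 'I_(nagents D).
Definition group := 'I_(ngroups D).
Definition link := 'I_(nlinks D).

Implicit Types (i j h : agent) (k : group) (l : link).

(* N^l *)
Definition users l : {set agent} := [set i | l \in links i].
(* G_k^l *)
Definition group_users k l : {set agent} :=
  [set i in users l | group_of i == k].
(* K^l *)
Definition link_groups l : {set group} := [set k | group_users k l != set0].
(* N(i) *)
Definition nbrs i : {set agent} := [set j | adj i j].
(* N^l(i) *)
Definition link_nbrs l i : {set agent} := nbrs i :&: users l.
(* I_i *)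
Definition clients i : {set agent} := [set h in nbrs i | Phi h == i].
(* C_i *)
Definition center_links i : {set link} :=
  [set l in links i | center (group_of i) l == i].

(* A cycle of size at most 2 is a vertex or an edge traversed back and forth. *)
Definition is_tree (n : nat) (e : rel 'I_n) : Prop :=
  [/\ symmetric e, irreflexive e, forall x y, connect e x y
    & forall s : seq 'I_n, ucycle e s -> (size s <= 2)%N].

Definition induced (n : nat) (e : rel 'I_n) (A : {set 'I_n}) : rel 'I_n :=
  [rel x y | [&& x \in A, y \in A & e x y]].

Record standing : Prop := Standing {
  capacity_gt0 : forall l, 0 < capacity l;
  link_groups_ge2 : forall l, (2 <= #|link_groups l|)%N;
  adj_tree : is_tree (@adj R D);
  Phi_nbr : forall i, Phi i \in nbrs i;
  users_connected : forall l,
    {in users l &, forall i j, connect (induced (@adj R D) (users l)) i j};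
  center_in : forall l k, k \in link_groups l ->
    center k l \in group_users k l;
  center_adj : forall l k, k \in link_groups l ->
    {in group_users k l, forall j, j != center k l -> adj (center k l) j} }.

(* The fields are, in order: y_i, underlined y_i, n_i, q_i, 1p_i, 2p_i, w_i,
   1z_i, 2z_i, 1a_i, 2a_i.  Pairs are ordered (j, l) as in the superscripts. *)
Record message i := Message {
  y_ : {nonneg R};
  yl_ : {ffun {l : link | l \in links i} -> {nonneg R}};
  n_ : {ffun {jl : agent * link | jl.1 \in nbrs i} -> {nonneg R}};
  q_ : {ffun {j : agent | j \in clients i} -> {nonneg R}};
  p1_ : {ffun {l : link | l \in links i} -> {nonneg R}};
  p2_ : {ffun {jl : agent * link |
           (jl.1 \in clients i) && (jl.2 \in links jl.1)} -> {nonneg R}};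
  w_ : {ffun {l : link | l \in links i} -> {nonneg R}};
  z1_ : {ffun {l : link | l \in center_links i} -> {nonneg R}};
  z2_ : {ffun {l : link | l \in center_links i} -> {nonneg R}};
  a1_ : {ffun {l : link | l \in links i} -> {posnum R}};
  a2_ : {ffun {jl : agent * link |
           (jl.1 \in clients i) && (jl.2 \in links jl.1)} -> {posnum R}} }.

(* Reads a family indexed by P at an arbitrary x, with value 0 outside P.
   Except for y_j^l, which is 0 by definition when l is not in L_j, the
   formulas below only read entries inside the index set. *)
Definition ext (T : Type) (P : pred T) (f : {x | P x} -> R) (x : T) : R :=
  if insub x is Some u then f u else 0.

Definition profile := forall i, message i.

(* The quotients are c^l / f_i^l and the one in delta_i^l.  When a
   denominator vanishes their meaning is left open: [rate0] gives r_i as an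
   arbitrary function of the vector (f_i^l)_l when some f_i^l is 0, and [quot0]
   gives the value of a / 0 in delta_i^l as an arbitrary function of a. *)
Context (rate0 : {ffun link -> R} -> R) (quot0 : R -> R).

Section Outcome.
Context (m : profile).

Definition y i : R := (y_ (m i))%:num.
Definition yl i l : R := ext (fun u => (yl_ (m i) u)%:num) l.
Definition n i j l : R := ext (fun u => (n_ (m i) u)%:num) (j, l).
Definition q i j : R := ext (fun u => (q_ (m i) u)%:num) j.
Definition p1 i l : R := ext (fun u => (p1_ (m i) u)%:num) l.
Definition p2 i j l : R := ext (fun u => (p2_ (m i) u)%:num) (j, l).
Definition w i l : R := ext (fun u => (w_ (m i) u)%:num) l.
Definition z1 i l : R := ext (fun u => (z1_ (m i) u)%:num) l.
Definition z2 i l : R := ext (fun u => (z2_ (m i) u)%:num) l.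
Definition a1 i l : R := ext (fun u => (a1_ (m i) u)%:num) l.
Definition a2 i j l : R := ext (fun u => (a2_ (m i) u)%:num) (j, l).

Definition ind (a b : R) : R := (a == b)%:R.

(* G_{k(i)}^l *)
Definition peers i l : {set agent} := group_users (group_of i) l.
(* c(k(i),l) *)
Definition ctr i l : agent := center (group_of i) l.

Definition z1bar i l : R :=
  if l \in center_links i
  then \big[Num.max/q (Phi i) i]_(j in peers i l | j != i) y j
  else z1 (ctr i l) l.

Definition z2bar i l : R :=
  if l \in center_links i
  then ind (q (Phi i) i) (z1bar i l)
       + \sum_(j in peers i l | j != i) ind (y j) (z1bar i l)
  else z2 (ctr i l) l.

Definition delta i l : R :=
  let a := q (Phi i) i * ind (q (Phi i) i) (z1bar i l) in
  if z2bar i l == 0 then quot0 a else a / z2bar i l.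

(* The sum over j in N(i) occurring in both f_i^l and S_i^l. *)
Definition nbr_load i j l : R :=
  yl j l + \sum_(h in nbrs j | h != i) n j h l.

Definition f i l : R :=
  (if l \in links i then delta i l else 0) + \sum_(j in nbrs i) nbr_load i j l.

(* The default value of the iterated minimum is one of the terms, so that
   this is the minimum over the nonempty set of links. *)
Definition r i : R :=
  let ratio l := capacity l / f i l in
  if [forall l, f i l != 0]
  then \big[Num.min/ratio (Ordinal (nlinks_gt0 D))]_(l : link) ratio l
  else rate0 [ffun l => f i l].

Definition xhat i : R := r i * y i.

Definition tax_c i : R :=
  \sum_(j in clients i) \sum_(l in links j)
     ((p2 i j l - p1 j l) ^+ 2 + (a2 i j l - a1 j l) ^+ 2)
  + \sum_(j in clients i) (q i j - y j) ^+ 2.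

(* S_i^l *)
Definition imbalance i l : R := \sum_(j in nbrs i) (n i j l - nbr_load i j l) ^+ 2.

(* For l in L_i, N^l(i) is nonempty: K^l has at least two elements and the
   subgraph on N^l is connected. *)
Definition wbar i l : R :=
  (#|link_nbrs l i|%:R)^-1 * \sum_(j in link_nbrs l i) w j l.

Definition what i l : R :=
  if l \in center_links i
  then \sum_(j in peers i l) p1 j l + (a1 i l - a2 (Phi i) i l)
  else w (ctr i l) l - p2 (Phi i) i l + p1 i l + (a1 i l - a2 (Phi i) i l).

Definition B i l : R :=
  p2 (Phi i) i l * xhat i
  + imbalance i l
  + (yl i l - delta i l) ^+ 2
  + wbar i l * (what i l - wbar i l) * (capacity l - r i * f i l) ^+ 2
  + (what i l - wbar i l) ^+ 2
  + p2 (Phi i) i l * (p1 i l - p2 (Phi i) i l)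
      * (z1bar i l - q (Phi i) i) ^+ 2.

Definition tax_l i l : R :=
  if l \notin links i then imbalance i l
  else if l \in center_links i then
    B i l + (z1 i l - z1bar i l) ^+ 2 + (z2 i l - z2bar i l) ^+ 2
    + (w i l - p2 (Phi i) i l - \sum_(j in peers i l | j != i) p1 j l) ^+ 2
  else B i l + (w i l - w (ctr i l) l) ^+ 2.

Definition taxhat i : R := tax_c i + \sum_(l : link) tax_l i l.

End Outcome.

Definition tree_mechanism : mechanism R agent := Mechanism xhat taxhat.

End Network.

(* Main.v *)
(** Fix an agent [i].  Every formula reads the messages of [i], of members of
    [N(i)] (among them [Phi i] and the agents of [I_i]), and, for a link [l] in
    [L_i], of the group peers of [i] on [l] when [i = c(k(i),l)], or of
    [c(k(i),l)] otherwise.  Since [c(k(i),l)] is adjacent to all the other nodes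
    of [G_{k(i)}^l], the latter agents are also neighbors of [i]. *)

Require Import Defs.
From mathcomp Require Import all_boot all_order all_algebra.
From mathcomp Require Import interval_inference reals.

Set Implicit Arguments.
Unset Strict Implicit.
Unset Printing Implicit Defensive.

Local Open Scope ring_scope.

Section Neighbors.
Context {R : realType} (D : network R) (D_standing : standing D).
Implicit Types (i j : agent D) (l : link D).

Lemma nbrsP i j : reflect (adj i j) (j \in nbrs i).
Proof. by rewrite inE; apply: idP. Qed.

Lemma clients_nbrs i j : j \in clients i -> j \in nbrs i.
Proof. by rewrite inE => /andP[]. Qed.

Lemma center_links_links i l : l \in center_links i -> l \in links i.
Proof. by rewrite inE => /andP[]. Qed.

Lemma links_peers i l : l \in links i -> i \in peers i l.
Proof. by move=> li; rewrite !inE li eqxx. Qed.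

(** The agent [i] itself witnesses that its group is present on [l]. This gives access to
    [center_adj], which is stated only for groups in [link_groups l]. *)
Lemma links_link_groups i l : l \in links i -> group_of i \in link_groups l.
Proof. by move=> li; rewrite inE; apply/set0Pn; exists i; apply: links_peers. Qed.

Lemma center_peers_nbrs i j l :
  l \in center_links i -> j \in peers i l -> j != i -> j \in nbrs i.
Proof.
move=> lC jp ji; have lL := center_links_links lC.
move: lC; rewrite inE => /andP[_ /eqP ci].
have := center_adj D_standing (links_link_groups lL) jp.
by rewrite ci => /(_ ji) /nbrsP.
Qed.

(** On a link used by [i], being outside [center_links i] means that the center differs from [i], so
    [center_adj] applies to [i]. The resulting edge starts at the center; symmetry of the tree
    reverses it. *)
Lemma ctr_nbrs i l :
  l \in links i -> l \notin center_links i -> ctr i l \in nbrs i.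
Proof.
move=> lL; rewrite inE lL /= => ci.
have [adj_sym _ _ _] := adj_tree D_standing.
apply/nbrsP; rewrite adj_sym.
apply: (center_adj D_standing (links_link_groups lL)); first exact: links_peers.
by rewrite eq_sym.
Qed.

End Neighbors.

Section Locality.
Context {R : realType} (D : network R) (D_standing : standing D).
Context (rate0 : {ffun link D -> R} -> R) (quot0 : R -> R).
Context (i : agent D) (m m' : profile D).
Context (mi : m i = m' i) (mN : forall j, j \in nbrs i -> m j = m' j).

Let mPhi : m (Phi i) = m' (Phi i).
Proof. exact/mN/(Phi_nbr D_standing). Qed.

Let m_clients j : j \in clients i -> m j = m' j.
Proof. by move=> /clients_nbrs /mN. Qed.

(** The case [j = i] is included because [what] sums over all peers, [i] among them. *)
Let m_peers l j : l \in center_links i -> j \in peers i l -> m j = m' j.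
Proof.
move=> lC jp; have [-> //|ji] := eqVneq j i.
exact/mN/(center_peers_nbrs D_standing lC jp).
Qed.

Let m_ctr l : l \in links i -> l \notin center_links i ->
  m (ctr i l) = m' (ctr i l).
Proof. by move=> lL lC; apply/mN/(ctr_nbrs D_standing). Qed.

Lemma z1bar_local l : l \in links i -> z1bar m i l = z1bar m' i l.
Proof.
move=> lL; rewrite /z1bar; case: ifPn => lC; last by rewrite /z1 m_ctr.
(* The initial value of the iterated maximum comes from the message of [Phi i] and must agree before
   the terms are compared. *)
rewrite {1}/q mPhi; apply: eq_bigr => j /andP[jp _].
by rewrite /y (m_peers lC jp).
Qed.

Lemma z2bar_local l : l \in links i -> z2bar m i l = z2bar m' i l.
Proof.
move=> lL; rewrite /z2bar; case: ifPn => lC; last by rewrite /z2 m_ctr.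
rewrite z1bar_local // {1}/q mPhi; congr (_ + _).
by apply: eq_bigr => j /andP[jp _]; rewrite /y (m_peers lC jp).
Qed.

Lemma delta_local l : l \in links i -> delta quot0 m i l = delta quot0 m' i l.
Proof.
by move=> lL; rewrite /delta z1bar_local // z2bar_local // /q mPhi.
Qed.

(** The index [h] may be two edges away from [i], but [n j h l] is an entry of the message of [j];
    no message of [h] is read. *)
Lemma nbr_load_local j l :
  j \in nbrs i -> nbr_load m i j l = nbr_load m' i j l.
Proof. by move=> ji; rewrite /nbr_load /yl /n mN. Qed.

Lemma f_local l : f quot0 m i l = f quot0 m' i l.
Proof.
rewrite /f; congr (_ + _); first by case: ifP => // /delta_local.
by apply: eq_bigr => j; apply: nbr_load_local.
Qed.

Lemma r_local : r rate0 quot0 m i = r rate0 quot0 m' i.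
Proof.
(* Both profiles satisfy the same nonvanishing test, hence take the same branch; otherwise [rate0],
   however chosen, receives equal vectors. *)
rewrite /r (eq_forallb (fun l => congr1 (fun x => x != 0) (f_local l))).
case: ifP => _; last by congr rate0; apply/ffunP => l; rewrite !ffunE f_local.
(* The first rewrite treats the default value of the minimum, the second its terms. *)
by rewrite f_local; apply: eq_bigr => l _; rewrite f_local.
Qed.

Lemma xhat_local : xhat rate0 quot0 m i = xhat rate0 quot0 m' i.
Proof. by rewrite /xhat r_local /y mi. Qed.

Lemma tax_c_local : tax_c m i = tax_c m' i.
Proof.
rewrite /tax_c; congr (_ + _); apply: eq_bigr => j ji.
  apply: eq_bigr => l _.
  by rewrite /p2 /p1 /a2 /a1 mi m_clients.
by rewrite /q /y mi m_clients.
Qed.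

Lemma imbalance_local l : imbalance m i l = imbalance m' i l.
Proof.
by apply: eq_bigr => j ji; rewrite nbr_load_local // /n mi.
Qed.

Lemma wbar_local l : wbar m i l = wbar m' i l.
Proof.
rewrite /wbar; congr (_ * _); apply: eq_bigr => j.
by rewrite inE => /andP[ji _]; rewrite /w mN.
Qed.

Lemma what_local l : l \in links i -> what m i l = what m' i l.
Proof.
move=> lL; rewrite /what /a1 /a2 /p2 mi mPhi.
case: ifPn => lC; last by rewrite /w /p1 m_ctr // mi.
congr (_ + _); apply: eq_bigr => j jp.
by rewrite /p1 (m_peers lC jp).
Qed.

Lemma B_local l :
  l \in links i -> B rate0 quot0 m i l = B rate0 quot0 m' i l.
Proof.
move=> lL; rewrite /B xhat_local imbalance_local delta_local // wbar_local.
by rewrite what_local // r_local f_local z1bar_local // /p2 /yl /p1 /q mi mPhi.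
Qed.

Lemma tax_l_local l : tax_l rate0 quot0 m i l = tax_l rate0 quot0 m' i l.
Proof.
(* Off [links i] only the imbalance remains, and it is local on every link; the terms involving
   peers or centers occur only for [l] in [links i]. *)
rewrite /tax_l imbalance_local; case: ifPn => // /negbNE lL.
rewrite B_local //; case: ifPn => lC; last by rewrite /w mi m_ctr.
rewrite z1bar_local // z2bar_local // /z1 /z2 /w /p2 mi mPhi.
congr (_ + (_ - _) ^+ 2); apply: eq_bigr => j /andP[jp _].
by rewrite /p1 (m_peers lC jp).
Qed.

Lemma taxhat_local : taxhat rate0 quot0 m i = taxhat rate0 quot0 m' i.
Proof.
by rewrite /taxhat tax_c_local; congr (_ + _); apply: eq_bigr => l _;
  apply: tax_l_local.
Qed.

End Locality.

Theorem fact1 (R : realType) (D : network R) (D_standing : standing D)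
    (rate0 : {ffun link D -> R} -> R) (quot0 : R -> R) :
  distributed (@adj R D) (tree_mechanism rate0 quot0).
Proof.
move=> i m m' eq_m.
have mi : m i = m' i by apply: eq_m; left.
have mN j : j \in nbrs i -> m j = m' j by move=> /nbrsP ij; apply: eq_m; right.
by split; [apply: xhat_local | apply: taxhat_local].
Qed.
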